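(* Let $X=\mathbb R_+=[0,\infty)$ be the set of non-negative reals with the standard metric. Then the cardinality of $M(X)$ is at least continuum.
   Context: For a metric space $(X,d_X)$ identify $X\sqcup X$ with $X\times\{0,1\}$ and write $x$ for $(x,0)$ and $x'$ for $(x,1)$. A metric $\rho$ on $X\sqcup X$ is compatible with $d_X$ if its restriction to each copy of $X$ equals $d_X$; the distance $\inf_{x,y\in X}\rho(x,y')$ between the two copies is assumed to be positive. Metrics $d,d'$ on a set $Z$ are coarsely equivalent if there is a monotone homeomorphism $\varphi$ of $(0,\infty)$ (with $\varphi(0)=0$) such that $d(z_1,z_2)\le\varphi(d'(z_1,z_2))$ and $d'(z_1,z_2)\le\varphi(d(z_1,z_2))$ for all $z_1,z_2\in Z$. $M(X)$ is the set of coarse equivalence classes of metrics on $X\sqcup X$ compatible with $d_X$. *)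

(* Defs.v *)
From HB Require Import structures.
From mathcomp Require Import all_boot all_order all_algebra.
From mathcomp Require Import all_classical all_reals all_analysis.

Set Implicit Arguments.
Unset Strict Implicit.
Unset Printing Implicit Defensive.

Import Order.TTheory GRing.Theory Num.Theory.
Import numFieldNormedType.Exports.

Local Open Scope classical_set_scope.
Local Open Scope ring_scope.

Definition homeomorphism_on (T U : topologicalType) (A : set T) (B : set U)
    (f : T -> U) : Prop :=
  exists g : U -> T,
    [/\ {homo f : x / A x >-> B x}, {homo g : y / B y >-> A y},
        {in A, cancel f g} /\ {in B, cancel g f},
        {within A, continuous f} & {within B, continuous g}].

Definition is_metric (R : realType) (Z : Type) (d : Z -> Z -> R) : Prop :=
  [/\ forall x y, 0 <= d x y,
      forall x y, d x y = 0 <-> x = y,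
      forall x y, d x y = d y x
    & forall x y z, d x z <= d x y + d y z].

(* Only the values of [phi] on [0, +oo[ matter. Since [phi] fixes 0 and maps
   ]0, +oo[ to itself, the only possible direction of monotonicity on
   [0, +oo[ is increasing. *)
Definition coarse_gauge (R : realType) (phi : R -> R) : Prop :=
  [/\ phi 0 = 0,
      {in `[0, +oo[ &, {homo phi : s t / s <= t}}
    & @homeomorphism_on R R `]0, +oo[ `]0, +oo[ phi].

Definition coarsely_equivalent (R : realType) (Z : Type) (d d' : Z -> Z -> R) :
    Prop :=
  exists phi : R -> R, coarse_gauge phi /\
    forall z1 z2, d z1 z2 <= phi (d' z1 z2) /\ d' z1 z2 <= phi (d z1 z2).

(* The double X x {0,1}: [(x, false)] is x, [(x, true)] is x'. The infimum is
   taken in the extended reals so that it is the usual one (+oo) for empty X. *)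
Definition compatible (R : realType) (X : metricType R)
    (rho : X * bool -> X * bool -> R) : Prop :=
  [/\ is_metric rho,
      forall (b : bool) (x y : X), rho (x, b) (y, b) = mdist x y
    & (0 < ereal_inf [set (rho (x, false) (y, true))%:E
                       | x in [set: X] & y in [set: X]])%E].

Definition M (R : realType) (X : metricType R) :
    set (set (X * bool -> X * bool -> R)) :=
  [set C | exists2 rho, compatible rho &
     C = [set rho' | compatible rho' /\ coarsely_equivalent rho rho']].
Arguments M {R} X.

Definition halfline (R : realType) : Type := set_type (`[0, +oo[%classic : set R).

HB.instance Definition _ (R : realType) := PseudoMetric.on (halfline R).

Section halfline_metric.
Variable R : realType.
Implicit Types x y : halfline R.

Let dist x y : R := `|val x - val y|.

Let dist_ge0 x y : 0 <= dist x y. Proof. exact: normr_ge0. Qed.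

Let dist_positivity x y : dist x y = 0 -> x = y.
Proof. by move=> /normr0_eq0/subr0_eq/val_inj. Qed.

Let ballEdist x (e : R) : ball x e = [set y | dist x y < e].
Proof. by []. Qed.

HB.instance Definition _ := @PseudoMetric_isMetric.Build R (halfline R)
  dist dist_ge0 dist_positivity ballEdist.

End halfline_metric.

Lemma halfline_mdistE (R : realType) (x y : halfline R) :
  mdist x y = `|val x - val y|.
Proof. by []. Qed.

(* Main.v *)
Require Import Defs.
From mathcomp Require Import all_boot all_order all_algebra.
From mathcomp Require Import all_classical all_reals all_analysis.
From mathcomp Require Import lra.

(** A nonnegative 1-Lipschitz function [f] on [X] yields a compatible metric
    [glue f] in which the distance from [x] to its twin [x'] is [1 + f x].
    If [glue f] and [glue g] are coarsely equivalent, then a gauge bounds the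
    twin distances of the second metric in terms of those of the first, so
    [g] is bounded on the zeros of [f] ([glue_coarse_bounded]). It is thus
    enough to find, on the half-line, a family of 1-Lipschitz functions indexed
    by the reals in which each member is unbounded on the zeros of every other.

    Take for [f] the distance to the geometric progression [4 ^ n * c] with
    [c] in [[1, 2]]. Progressions with ratio 4 started in [[1, 2]] occupy
    blocks [[4 ^ n, 2 * 4 ^ n]] separated by gaps comparable to [4 ^ n]. If
    [s] differs from [c], the point [4 ^ n * c] is at distance
    [4 ^ n * `|c - s|] from the point of the other progression in its own
    block, and at least of order [4 ^ n] from all its other points
    ([geometric_gap]). Hence its distance to that progression tends to
    infinity with [n] ([geometric_far]). Finally the reals inject into
    [[1, 2]] ([initial_inj]), and as coarse equivalence is reflexive, distinct
    parameters give distinct classes. *)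

Local Open Scope classical_set_scope.
Local Open Scope card_scope.

Import Order.TTheory GRing.Theory Num.Theory.

Section Gluing.
Local Open Scope ring_scope.
Context {R : realType} {X : metricType R}.
Implicit Types (f g : X -> R) (x y : X) (A : set X).

Definition nonexpansive f : Prop := forall x y, f x <= f y + mdist x y.

(** The maximum, rather than a sum, keeps the triangle inequality with only
    a 1-Lipschitz [f], and the 1 keeps the two copies apart where [f]
    vanishes. *)
Definition glue f (p q : X * bool) : R :=
  if p.2 == q.2 then mdist p.1 q.1
  else 1 + Num.max (mdist p.1 q.1) (Num.max (f p.1) (f q.1)).

(** For a triangle with vertices in both copies, each term of the maximum
    changes by at most the length of the side lying inside one copy. *)
Lemma glue_metric f : nonexpansive f -> is_metric (glue f).
Proof.
move=> f_ne; rewrite /glue; split.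
- move=> [x b] [y c] /=; case: ifP => _; first exact: mdist_ge0.
  by rewrite addr_ge0// le_max mdist_ge0.
- move=> [x b] [y c] /=; split=> [|[-> ->]]; last by rewrite eqxx mdistxx.
  case: eqP => [-> /mdist_positivity -> //|_ eq0].
  suff : 1 <= (0 : R) by rewrite ler10.
  by rewrite -eq0 lerDl le_max mdist_ge0.
- move=> [x b] [y c] /=; rewrite eq_sym metric_sym.
  by congr (if _ then _ else _ + Num.max _ _); exact: maxC.
move=> [x b] [y c] [z d] /=.
have tri := metric_triangle x y z.
have := f_ne x y; have := f_ne z y; rewrite (metric_sym z y) => fzy fxy.
have := mdist_ge0 x y; have := mdist_ge0 y z => yz0 xy0.
(* One case per distribution of the vertices over the two copies. *)
case: b; case: c; case: d => //=.
all: by rewrite /Num.max; repeat case: ifPn; rewrite -?leNgt; lra.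
Qed.

Lemma glue_compatible f : nonexpansive f -> compatible (glue f).
Proof.
move=> f_ne; split; first exact: glue_metric.
- by move=> b x y; rewrite /glue eqxx.
apply: (@lt_le_trans _ _ 1%E); first exact: lte01.
apply: le_ereal_inf_tmp => _ [x _ [y _ <-]].
by rewrite lee_fin /glue /= lerDl le_max mdist_ge0.
Qed.

(** The invariant that separates the classes: twins over a zero of [f] are at
    distance 1 for [glue f], hence at distance at most [phi 1] for [glue g]. *)
Lemma glue_coarse_bounded f g :
  coarsely_equivalent (glue f) (glue g) ->
  exists phi : R -> R, forall x, f x = 0 -> g x <= phi 1.
Proof.
move=> [phi [_ gauge]]; exists phi => x fx0.
have [_] := gauge (x, false) (x, true).
rewrite /glue /= mdistxx fx0 !maxxx addr0; apply: le_trans.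
by apply: ler_wpDl => //; rewrite le_max lexx orbT.
Qed.

Definition set_dist A x : R := inf [set mdist x a | a in A].

Lemma set_dist_le A x a : A a -> set_dist A x <= mdist x a.
Proof.
move=> Aa; apply: ge_inf; last by exists a.
by exists 0 => _ [y _ <-]; exact: mdist_ge0.
Qed.

Lemma le_set_dist A x (r : R) : A !=set0 ->
  (forall a, A a -> r <= mdist x a) -> r <= set_dist A x.
Proof.
move=> [a Aa] rA; apply: lb_le_inf; first by exists (mdist x a), a.
by move=> _ [y Ay <-]; exact: rA.
Qed.

Lemma set_dist_nonexpansive A : A !=set0 -> nonexpansive (set_dist A).
Proof.
move=> A0 x y; rewrite -lerBlDr; apply: le_set_dist => // a Aa.
rewrite lerBlDr addrC; apply: le_trans (metric_triangle x y a).
exact: set_dist_le.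
Qed.

Lemma set_dist_eq0 A a : A a -> set_dist A a = 0.
Proof.
move=> Aa; apply/eqP; rewrite eq_le; apply/andP; split.
  by rewrite -(mdistxx a); exact: set_dist_le.
by apply: le_set_dist => [|y _]; [by exists a | exact: mdist_ge0].
Qed.

End Gluing.

Section Equivalence.
Local Open Scope ring_scope.
Context {R : realType} {Z : Type}.

Lemma coarse_gauge_id : coarse_gauge (@id R).
Proof.
split=> //; exists id; split=> //;
  by apply: continuous_subspaceT => x; exact: cvg_id.
Qed.

Lemma coarsely_equivalent_refl (d : Z -> Z -> R) : coarsely_equivalent d d.
Proof. by exists id; split=> [|//]; exact: coarse_gauge_id. Qed.

End Equivalence.

Section Geometric.
Local Open Scope ring_scope.
Context {R : realType}.
Implicit Types (c s : R) (n m : nat).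

Definition geometric_set c : set (halfline R) :=
  [set x | exists n, val x = 4 ^+ n * c].

Lemma geometric_point c n : 0 <= c -> exists x : halfline R, val x = 4 ^+ n * c.
Proof.
move=> c0.
have xP : 4 ^+ n * c \in (`[0, +oo[%classic : set R).
  by rewrite inE /= in_itv /= andbT mulr_ge0 ?exprn_ge0.
by exists (SigSub xP).
Qed.

(** The factor 2 comes from the block just below, [m = n - 1], where a point
    can be as large as [2 * 4 ^ (n - 1)], that is, half of [4 ^ n]. The blocks
    above leave more room, at least [4 ^ (n + 1) - 2 * 4 ^ n], and within the
    common block the points are exactly [4 ^ n * `|c - s|] apart. *)
Lemma geometric_gap c s n m : 1 <= c <= 2 -> 1 <= s <= 2 ->
  4 ^+ n * `|c - s| <= 2 * `|4 ^+ n * c - 4 ^+ m * s|.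
Proof.
move=> /andP[c1 c2] /andP[s1 s2].
have pow_gt0 k : 0 < (4 : R) ^+ k by rewrite exprn_gt0.
have pow_step k l : (k < l)%N -> 4 * (4 : R) ^+ k <= 4 ^+ l.
  by move=> kl; rewrite -exprS ler_weXn2l// ler1n.
have cs1 : `|c - s| <= 1 by rewrite ler_norml; apply/andP; split; lra.
have P0 := pow_gt0 n; have Q0 := pow_gt0 m.
have gap_le : 4 ^+ n * `|c - s| <= 4 ^+ n by rewrite ler_piMr// ltW.
have cn_bounds : 4 ^+ n <= 4 ^+ n * c <= 2 * 4 ^+ n.
  by rewrite mulrC ler_peMl ?ler_wpM2r// ltW.
have sm_bounds : 4 ^+ m <= 4 ^+ m * s <= 2 * 4 ^+ m.
  by rewrite mulrC ler_peMl ?ler_wpM2r// ltW.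
have [nm|mn|->] := ltngtP n m; last 1 first.
- by rewrite -mulrBr normrM gtr0_norm// ler_peMl ?ler1n// mulr_ge0// ltW.
- have := pow_step _ _ nm; rewrite (distrC (4 ^+ n * c)).
  by have := ler_norm (4 ^+ m * s - 4 ^+ n * c); lra.
- have := pow_step _ _ mn.
  by have := ler_norm (4 ^+ n * c - 4 ^+ m * s); lra.
Qed.

(** By the gap estimate, the distance from the [n]-th point of one progression
    to the whole other one is at least [4 ^ n * `|c - s| / 2], which exceeds
    [r] for large [n]. *)
Lemma geometric_far c s (r : R) : 1 <= c <= 2 -> 1 <= s <= 2 -> c != s ->
  exists2 x, geometric_set c x & r < set_dist (geometric_set s) x.
Proof.
move=> c12 s12 cs.
have gap : 0 < `|c - s| by rewrite normr_gt0 subr_eq0.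
have c0 : 0 <= c by case/andP: c12 => c1 _; exact: le_trans c1.
have s0 : 0 <= s by case/andP: s12 => s1 _; exact: le_trans s1.
have [n rn] : exists n, 2 * r < 4 ^+ n * `|c - s|.
  exists (Num.bound (2 * r / `|c - s|)); rewrite -ltr_pdivrMr//.
  apply: lt_le_trans (upper_nthrootP (leqnn _)) _.
  by apply: lerXn2r; rewrite ?nnegrE ?ler_nat.
have [x xE] := geometric_point c n c0; exists x; first by exists n.
apply: (@lt_le_trans _ _ (4 ^+ n * `|c - s| / 2)); first by lra.
apply: le_set_dist.
  by have [y yE] := geometric_point s 0 s0; exists y, 0%N.
move=> a [m aE]; rewrite halfline_mdistE xE aE.
by have := geometric_gap c s n m c12 s12; lra.
Qed.

(** An explicit injection of the reals into [[1, 2]], the range of initial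
    terms for which the progressions separate. *)
Definition initial (t : R) : R := 1 + (1 + expR t)^-1.

Lemma initial_itv t : 1 <= initial t <= 2.
Proof.
have e0 := expR_gt0 t; rewrite /initial lerDl invr_ge0.
have : (1 + expR t)^-1 <= 1 by rewrite invf_le1; lra.
by move=> inv_le1; apply/andP; split; lra.
Qed.

Lemma initial_inj : injective initial.
Proof. by move=> t u /addrI /invr_inj /addrI /expR_inj. Qed.

Definition geometric_metric (t : R) : halfline R * bool -> halfline R * bool -> R :=
  glue (set_dist (geometric_set (initial t))).

Lemma geometric_metric_compatible t : compatible (geometric_metric t).
Proof.
apply/glue_compatible/set_dist_nonexpansive.
have r0 : 0 <= initial t by case/andP: (initial_itv t) => r1 _; exact: le_trans r1.
by have [x xE] := geometric_point _ 0 r0; exists x, 0%N.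
Qed.

Lemma geometric_metric_inj t u :
  coarsely_equivalent (geometric_metric t) (geometric_metric u) -> t = u.
Proof.
move=> /glue_coarse_bounded [phi bound]; apply: initial_inj; apply/eqP.
apply: contraT => tu.
have [x xt] := geometric_far _ _ (phi 1) (initial_itv t) (initial_itv u) tu.
by rewrite ltNge bound// set_dist_eq0.
Qed.

End Geometric.

Theorem lemma1p1 (R : realType) : [set: R] #<= M (halfline R).
Proof.
pose cls (t : R) := [set rho |
  compatible rho /\ coarsely_equivalent (geometric_metric t) rho].
have cls_inj : {in [set: R] &, injective cls}.
  move=> t u _ _ tu; apply: geometric_metric_inj.
  have : cls u (geometric_metric u).
    by split; [exact: geometric_metric_compatible|exact: coarsely_equivalent_refl].
  by rewrite -tu => -[].
rewrite -(card_le_eql (inj_card_eq cls_inj)).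
apply: subset_card_le => _ [t _ <-].
by exists (geometric_metric t) => //; exact: geometric_metric_compatible.
Qed.
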